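(* For any integer $n \geq 3$, any residue $\bar\imath$ modulo $n$, and any partition $\lambda \in B^H$, we have $$\Psi(\tilde e_{\bar\imath}^H \lambda) = \tilde e_{\bar\imath}^M \Psi(\lambda) \quad\text{and}\quad \Psi(\tilde f_{\bar\imath}^H \lambda) = \tilde f_{\bar\imath}^M \Psi(\lambda).$$
   Context: Fix an integer $n \ge 3$. For an integer $c$, $\bar c$ denotes its residue modulo $n$. **Partitions.** A partition $\lambda=(\lambda_1,\ldots,\lambda_N)$ is a finite non-increasing sequence of positive integers (the empty partition is allowed); $\mathcal P$ is the set of all partitions. The diagram of $\lambda$ has $\lambda_i$ boxes in row $i$; the $j$-th box of row $i$ has coordinates $(x,y)=(i-\tfrac12,\,j-\tfrac12)$. Partitions are identified with their diagrams. For a box $b=(x_b,y_b)$: the content is $c(b)=y_b-x_b$, the color is the residue $\bar c(b)$ of $c(b)$ modulo $n$, and the height is $h(b)=x_b+y_b$. For a box $b$ in $\lambda$, $\mathrm{arm}(b)=\lambda_{x_b+1/2}-y_b-\tfrac12$ and $\mathrm{hook}(b)=\lambda_{x_b+1/2}-y_b+\lambda'_{y_b+1/2}-x_b$, where $\lambda_{x_b+1/2}$ is the length of the row containing $b$ and $\lambda'_{y_b+1/2}$ is the length of the column containing $b$. $A(\lambda)$ is the set of boxes which can be added to $\lambda$ so that the result is still a partition; $R(\lambda)$ is the set of boxes which can be removed from $\lambda$ so that the result is still a partition. For a residue $\bar\imath$ modulo $n$, $A_{\bar\imath}(\lambda)=\{b\in A(\lambda): \bar c(b)=\bar\imath\}$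 and $R_{\bar\imath}(\lambda)=\{b\in R(\lambda): \bar c(b)=\bar\imath\}$. **The set $B^H$.** Let $A^H_t=\lceil nt/2\rceil-1$ for integers $t\ge1$. A box $b$ of $\lambda$ is $A^H$-illegal if for some integer $t\ge 1$, $\mathrm{hook}(b)=nt$ and $\mathrm{arm}(b)=A^H_t$. $B^H$ is the set of partitions with no $A^H$-illegal box. **The operators $\tilde e^H_{\bar\imath},\tilde f^H_{\bar\imath}$.** Define a total order $\succ_{A^H}$ on $A_{\bar\imath}(\lambda)\cup R_{\bar\imath}(\lambda)$: for distinct $b=(x,y)$, $b'=(x',y')$, labelled so that $c(b')-c(b)=nt$ with $t>0$, set $b'\succ_{A^H}b$ if $y'-y>A^H_t$, and $b\succ_{A^H}b'$ otherwise. Let $S^H_{\bar\imath}(\lambda)$ be the string of brackets having a ''('' for every $b\in A_{\bar\imath}(\lambda)$ and a '')'' for every $b\in R_{\bar\imath}(\lambda)$, placed in decreasing order from left to right with respect to $\succ_{A^H}$. Cancel brackets by the usual rule (repeatedly cancel a ''('' with a '')'' immediately to its right, ignoring already cancelled brackets). Define maps $\mathcal P\cup\{0\}\to\mathcal P\cup\{0\}$ by $\tilde e^H_{\bar\imath}(0)=\tilde f^H_{\bar\imath}(0)=0$ and: - $\tilde e^H_{\bar\imath}(\lambda)=\lambda\setminus b$ if the first uncanceled '')'' from the right corresponds to $b$, and $0$ if there is no uncanceled '')''; - $\tilde f^H_{\bar\imath}(\lambda)=\lambda\sqcup b$ if the first uncanceled ''('' from the left corresponds to $b$, and $0$ if there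 is no uncanceled ''(''. **Monomials.** Let $Y_{\bar\imath,k}$ ($\bar\imath\in\mathbb Z/n\mathbb Z$, $k\in\mathbb Z$) be commuting formal variables, and let $\mathcal M$ be the set of monomials $m=\prod Y_{\bar\imath,k}^{u_{\bar\imath,k}(m)}$ with all $u_{\bar\imath,k}(m)\in\mathbb Z$ and all but finitely many equal to $0$. Let $A_{\bar\imath,k}=Y_{\bar\imath,k-1}Y_{\bar\imath,k+1}Y_{\bar\imath+\bar1,k}^{-1}Y_{\bar\imath-\bar1,k}^{-1}$. For $L\in\mathbb Z$ set $$\varepsilon_{\bar\imath,L}(m)=-\sum_{l\ge L}u_{\bar\imath,l}(m),\qquad \varphi_{\bar\imath,L}(m)=\sum_{l\le L}u_{\bar\imath,l}(m),$$ $\varepsilon_{\bar\imath}(m)=\max_L\varepsilon_{\bar\imath,L}(m)$, $p_{\bar\imath}(m)=\max\{L:\varepsilon_{\bar\imath,L}(m)=\varepsilon_{\bar\imath}(m)\}$, $\varphi_{\bar\imath}(m)=\max_L\varphi_{\bar\imath,L}(m)$, $q_{\bar\imath}(m)=\min\{L:\varphi_{\bar\imath,L}(m)=\varphi_{\bar\imath}(m)\}$. (If $\varepsilon_{\bar\imath}(m)>0$ then $p_{\bar\imath}(m)$ is finite; if $\varphi_{\bar\imath}(m)>0$ then $q_{\bar\imath}(m)$ is finite.) Define maps $\mathcal M\cup\{0\}\to\mathcal M\cup\{0\}$ by $\tilde e^M_{\bar\imath}(0)=\tilde f^M_{\bar\imath}(0)=0$ and: - $\tilde e^M_{\bar\imath}(m)=0$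 if $\varepsilon_{\bar\imath}(m)=0$, and $A_{\bar\imath,p_{\bar\imath}(m)-1}\,m$ if $\varepsilon_{\bar\imath}(m)>0$; - $\tilde f^M_{\bar\imath}(m)=0$ if $\varphi_{\bar\imath}(m)=0$, and $A_{\bar\imath,q_{\bar\imath}(m)+1}^{-1}\,m$ if $\varphi_{\bar\imath}(m)>0$. **The map $\Psi$.** $\Psi:\mathcal P\cup\{0\}\to\mathcal M\cup\{0\}$ is defined by $\Psi(0)=0$ and, for $\lambda\in\mathcal P$, $$\Psi(\lambda)=\prod_{b\in A(\lambda)}Y_{\bar c(b),h(b)-1}\prod_{b\in R(\lambda)}Y_{\bar c(b),h(b)+1}^{-1}.$$ *)

(* Defs.v *)
From HB Require Import structures.
From mathcomp Require Import all_boot all_order all_algebra.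
From mathcomp Require Import zify.
From mathcomp Require Import boolp classical_sets.
From mathcomp Require Import freeg.

Set Implicit Arguments.
Unset Strict Implicit.
Unset Printing Implicit Defensive.

Import Order.TTheory GRing.Theory Num.Theory.

Local Open Scope ring_scope.

Definition is_part (s : seq nat) : bool := sorted geq s && (0%N \notin s).

Record intpart := IntPart { rows :> seq nat; _ : is_part rows }.
HB.instance Definition _ := [isSub for rows].
HB.instance Definition _ := [Choice of intpart by <:].

(* Rows and columns are numbered from 0: the pair (i, j) stands for the box *)
(* with coordinates x = i + 1/2 and y = j + 1/2.                            *)
Notation box := (nat * nat)%type.

Definition row_len (s : seq nat) (i : nat) : nat := nth 0%N s i.
Definition col_len (s : seq nat) (j : nat) : nat := count (fun p => j < p)%N s.

Definition in_diagram (s : seq nat) (b : box) : bool := (b.2 < row_len s b.1)%N.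

Definition content (b : box) : int := b.2%:Z - b.1%:Z.
Definition color (n : nat) (b : box) : 'Z_n := (content b)%:~R.
(* x + y = i + j + 1 *)
Definition height (b : box) : int := (b.1 + b.2).+1%:Z.

(* arm = row_len - y - 1/2 and hook = row_len - y + col_len - x; the        *)
(* truncated subtractions are exact when b belongs to the diagram.          *)
Definition arm (s : seq nat) (b : box) : nat := (row_len s b.1 - b.2 - 1)%N.
Definition hook (s : seq nat) (b : box) : nat :=
  (row_len s b.1 + col_len s b.2 - (b.1 + b.2).+1)%N.

(* Addable and removable boxes; addableP and removableP below relate these *)
(* to the diagrams.  Row b.1 may become empty when b is removed, whence the *)
(* filter in [shrink].                                                      *)
Definition addable (lam : intpart) (b : box) : bool :=
  (b.2 == row_len lam b.1) && is_part (incr_nth lam b.1).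
Definition add_box (lam : intpart) (b : box) : intpart :=
  insubd lam (incr_nth lam b.1).

Definition decr_row (s : seq nat) (i : nat) : seq nat :=
  set_nth 0%N s i (row_len s i).-1.
Definition shrink (s : seq nat) (i : nat) : seq nat :=
  [seq p <- decr_row s i | (0 < p)%N].
Definition removable (lam : intpart) (b : box) : bool :=
  (b.2.+1 == row_len lam b.1) && sorted geq (decr_row lam b.1).
Definition rem_box (lam : intpart) (b : box) : intpart :=
  insubd lam (shrink lam b.1).

(* The finite sets A(lam) and R(lam), listed without repetition by rows.    *)
Definition addables (lam : intpart) : seq box :=
  [seq b <- [seq (i, row_len lam i) | i <- iota 0 (size lam).+1] | addable lam b].
Definition removables (lam : intpart) : seq box :=
  [seq b <- [seq (i, (row_len lam i).-1) | i <- iota 0 (size lam)] | removable lam b].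

(* ceil(nt/2) - 1, used for t >= 1 only *)
Definition AH (n t : nat) : nat := (uphalf (n * t)).-1.

Definition illegal (n : nat) (lam : intpart) (b : box) : Prop :=
  exists t : nat, [/\ (1 <= t)%N, hook lam b = (n * t)%N & arm lam b = AH n t].

Definition BH (n : nat) (lam : intpart) : Prop :=
  forall b : box, in_diagram lam b -> ~ illegal n lam b.

(* Reflexive closure of the order "b succeeds b'", for boxes whose contents *)
(* are congruent modulo n.                                                  *)
Definition geH (n : nat) (b b' : box) : bool :=
  (b == b') ||
  let d := content b - content b' in
  let t := (`|d|%N %/ n)%N in
  if 0 < d then (AH n t)%:Z < b.2%:Z - b'.2%:Z
  else ~~ ((AH n t)%:Z < b'.2%:Z - b.2%:Z).

(* A bracket is paired with its box: (true, b) is "(" and (false, b) is ")". *)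
Notation bracket := (bool * box)%type.

Definition brackets (n : nat) (i : 'Z_n) (lam : intpart) : seq bracket :=
  [seq (true, b) | b <- addables lam & color n b == i] ++
  [seq (false, b) | b <- removables lam & color n b == i].

Definition SH (n : nat) (i : 'Z_n) (lam : intpart) : seq bracket :=
  sort (fun p q => geH n p.2 q.2) (brackets i lam).

(* [st] lists, last one first, the brackets read so far that are uncanceled. *)
Definition cancel_step (st : seq bracket) (p : bracket) : seq bracket :=
  if st is q :: st' then if q.1 && ~~ p.1 then st' else p :: st else [:: p].

Definition uncanceled (s : seq bracket) : seq bracket :=
  rev (foldl cancel_step [::] s).

(* [None] is the extra element 0. *)
Definition eH (n : nat) (i : 'Z_n) (x : option intpart) : option intpart :=
  if x is Some lam then
    if ohead (rev [seq p.2 | p <- uncanceled (SH i lam) & ~~ p.1]) is Some b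
    then Some (rem_box lam b) else None
  else None.

Definition fH (n : nat) (i : 'Z_n) (x : option intpart) : option intpart :=
  if x is Some lam then
    if ohead [seq p.2 | p <- uncanceled (SH i lam) & p.1] is Some b
    then Some (add_box lam b) else None
  else None.

(* The monomial group is written additively: it is the free abelian group  *)
(* on the Y_{i,k}.                                                          *)
Definition monomial (n : nat) := {freeg ('Z_n * int)%type / int}.

Definition Y (n : nat) (i : 'Z_n) (k : int) : monomial n := << (i, k) >>.

Definition expo (n : nat) (m : monomial n) (i : 'Z_n) (k : int) : int :=
  coeff (i, k) m.

Definition Amon (n : nat) (i : 'Z_n) (k : int) : monomial n :=
  Y i (k - 1) + Y i (k + 1) - Y (i + 1) k - Y (i - 1) k.

(* [dom m] is the duplicate-free list of the (i, k) with expo m i k != 0.   *)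
Definition epsL (n : nat) (i : 'Z_n) (L : int) (m : monomial n) : int :=
  - \sum_(x <- dom m | (x.1 == i) && (L <= x.2)) expo m i x.2.
Definition phiL (n : nat) (i : 'Z_n) (L : int) (m : monomial n) : int :=
  \sum_(x <- dom m | (x.1 == i) && (x.2 <= L)) expo m i x.2.

Definition is_greatest (P : set int) (v : int) : Prop :=
  P v /\ forall w, P w -> w <= v.
Definition is_least (P : set int) (v : int) : Prop :=
  P v /\ forall w, P w -> v <= w.

(* Junk value 0 when there is no greatest (least) element. *)
Definition maxZ (P : set int) : int := xget 0 (is_greatest P).
Definition minZ (P : set int) : int := xget 0 (is_least P).

Definition eps (n : nat) (i : 'Z_n) (m : monomial n) : int :=
  maxZ [set v | exists L, epsL i L m = v]%classic.
Definition phi (n : nat) (i : 'Z_n) (m : monomial n) : int :=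
  maxZ [set v | exists L, phiL i L m = v]%classic.
Definition pM (n : nat) (i : 'Z_n) (m : monomial n) : int :=
  maxZ [set L | epsL i L m = eps i m]%classic.
Definition qM (n : nat) (i : 'Z_n) (m : monomial n) : int :=
  minZ [set L | phiL i L m = phi i m]%classic.

Definition eM (n : nat) (i : 'Z_n) (x : option (monomial n)) :
    option (monomial n) :=
  if x is Some m then
    if 0 < eps i m then Some (Amon i (pM i m - 1) + m) else None
  else None.

Definition fM (n : nat) (i : 'Z_n) (x : option (monomial n)) :
    option (monomial n) :=
  if x is Some m then
    if 0 < phi i m then Some (- Amon i (qM i m + 1) + m) else None
  else None.

Definition Psi (n : nat) (x : option intpart) : option (monomial n) :=
  if x is Some lam then
    Some (\sum_(b <- addables lam) Y (color n b) (height b - 1)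
          - \sum_(b <- removables lam) Y (color n b) (height b + 1))
  else None.

Lemma sorted_geqP (s : seq nat) :
  reflect (forall i, row_len s i.+1 <= row_len s i)%N (sorted geq s).
Proof.
apply: (iffP (sortedP 0%N)) => [h i | h i _]; last exact: h.
by case: (ltnP i.+1 (size s)) => [/h // | le_s]; rewrite /row_len nth_default.
Qed.

Lemma is_partP (s : seq nat) :
  reflect ((forall i, row_len s i.+1 <= row_len s i)%N /\
           (forall i, i < size s -> 0 < row_len s i)%N) (is_part s).
Proof.
apply: (iffP andP) => -[h1 h2]; split; try exact/sorted_geqP.
  move=> i lti; rewrite lt0n; apply: contra h2 => /eqP <-; exact: mem_nth.
apply/negP => /(nthP 0%N)[i lti ei]; have := h2 i lti.
by rewrite /row_len ei.
Qed.

Lemma intpartP (lam : intpart) : is_part lam.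
Proof. by case: lam. Qed.

Lemma row_le (s : seq nat) i j :
  sorted geq s -> (i <= j -> row_len s j <= row_len s i)%N.
Proof.
move/sorted_geqP => h; elim: j => [|j IH]; first by rewrite leqn0 => /eqP ->.
rewrite leq_eqVlt => /orP[/eqP -> // | /IH]; exact: leq_trans.
Qed.

Lemma intpart_sorted (lam : intpart) : sorted geq lam.
Proof. by have /andP[] := intpartP lam. Qed.

Lemma row_gt0 (lam : intpart) i : (0 < row_len lam i)%N = (i < size lam)%N.
Proof.
case: (ltnP i (size lam)) => h; last by rewrite /row_len nth_default.
by have /is_partP[_ ->] := intpartP lam.
Qed.

Lemma in_diagram_inj (lam mu : intpart) :
  in_diagram lam =1 in_diagram mu -> lam = mu.
Proof.
move=> h; have row_eq i : row_len lam i = row_len mu i.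
  have := h (i, row_len lam i); have := h (i, row_len mu i).
  by rewrite /in_diagram /= !ltnn; case: ltngtP.
apply: val_inj; apply: (@eq_from_nth _ 0%N) => [|i _]; last exact: row_eq.
have eqs i : (i < size lam)%N = (i < size mu)%N by rewrite -!row_gt0 row_eq.
by have := eqs (size lam); have := eqs (size mu); rewrite !ltnn; case: ltngtP.
Qed.

Lemma row_len_incr (s : seq nat) r i :
  row_len (incr_nth s r) i = ((r == i) + row_len s i)%N.
Proof. exact: nth_incr_nth. Qed.

Lemma row_len_decr (s : seq nat) r i :
  row_len (decr_row s r) i = (row_len s i - (r == i))%N.
Proof.
rewrite /decr_row /row_len nth_set_nth /= eq_sym.
by case: eqP => [->|_]; rewrite ?subn1 ?subn0.
Qed.

Lemma row_len_filter (s : seq nat) i :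
  sorted geq s -> row_len [seq p <- s | 0 < p]%N i = row_len s i.
Proof.
elim: s i => [|[|p] s IH] i //= srt; last first.
  by case: i => [|i] //=; apply: IH; exact: path_sorted srt.
have z j : row_len (0%N :: s) j = 0%N.
  by apply/eqP; rewrite -leqn0; exact: (@row_le (0%N :: s) 0 j srt).
rewrite IH ?(path_sorted srt) // z; exact: (z i.+1).
Qed.

Lemma add_boxE (lam : intpart) (b : box) :
  addable lam b -> rows (add_box lam b) = incr_nth lam b.1.
Proof. by case/andP => _ h; rewrite [LHS]val_insubd h. Qed.

Lemma in_diagram_add (lam : intpart) (b : box) :
  addable lam b ->
  forall b', in_diagram (add_box lam b) b' = in_diagram lam b' || (b' == b).
Proof.
move=> h [i j]; rewrite /in_diagram add_boxE // row_len_incr.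
case/andP: h => /eqP; case: b => r c /= -> _.
by rewrite xpair_eqE; case: (eqVneq r i) => [->|/negPf ne];
  rewrite ?eqxx /= ?(eq_sym i) ?ne ?orbF //; lia.
Qed.

Lemma addableP (lam : intpart) (b : box) :
  reflect (~~ in_diagram lam b /\
           exists mu : intpart, forall b',
             in_diagram mu b' = in_diagram lam b' || (b' == b))
          (addable lam b).
Proof.
apply: (iffP idP) => [h | ].
  split; last by exists (add_box lam b); exact: in_diagram_add.
  by case/andP: h => /eqP h _; rewrite /in_diagram h ltnn.
case: b => r c [nb [mu hmu]]; have e i j := hmu (i, j).
rewrite /in_diagram /= in nb e.
have er : row_len lam r = c /\ row_len mu r = c.+1.
  move: (e r c) (e r c.+1) (e r (row_len lam r)); rewrite !xpair_eqE !eqxx /=.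
  lia.
have ei i : row_len mu i = ((r == i) + row_len lam i)%N.
  case: (eqVneq r i) => [<-|ne]; first by case: er => -> ->.
  have := e i (row_len lam i); have := e i (row_len mu i).
  by rewrite !xpair_eqE eq_sym (negPf ne) /= !orbF !ltnn; case: ltngtP.
rewrite /addable /=; case: er => -> ecr; rewrite eqxx /=.
apply/is_partP; split=> [i | i]; rewrite !row_len_incr -!ei.
  exact/sorted_geqP/intpart_sorted.
rewrite size_incr_nth; case: (ltnP r (size lam)) => [_ | _].
  by rewrite ei -row_gt0; lia.
rewrite ltnS => le_ir.
by apply: leq_trans (row_le (intpart_sorted mu) le_ir); rewrite ecr.
Qed.

Lemma is_part_shrink (s : seq nat) r : 
  sorted geq (decr_row s r) -> is_part (shrink s r).
Proof.
move=> srt; apply/andP; split; last by rewrite mem_filter.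
by apply: sorted_filter => // x y z; rewrite /geq /= => h1 h2; exact: leq_trans h2 h1.
Qed.

Lemma rem_boxE (lam : intpart) (b : box) :
  removable lam b -> rows (rem_box lam b) = shrink lam b.1.
Proof. by case/andP => _ h; rewrite [LHS]val_insubd is_part_shrink. Qed.

Lemma in_diagram_rem (lam : intpart) (b : box) :
  removable lam b ->
  forall b', in_diagram (rem_box lam b) b' = in_diagram lam b' && (b' != b).
Proof.
move=> h [i j]; rewrite /in_diagram rem_boxE //=; case/andP: h => /eqP h srt.
rewrite row_len_filter // row_len_decr; case: b h {srt} => r c /= h.
rewrite xpair_eqE; case: (eqVneq r i) => [<-|/negPf ne].
  by rewrite -h; lia.
by rewrite subn0 andbT.
Qed.

Lemma removableP (lam : intpart) (b : box) :
  reflect (in_diagram lam b /\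
           exists mu : intpart, forall b',
             in_diagram mu b' = in_diagram lam b' && (b' != b))
          (removable lam b).
Proof.
apply: (iffP idP) => [h | ].
  split; last by exists (rem_box lam b); exact: in_diagram_rem.
  by case/andP: h => /eqP h _; rewrite /in_diagram -h.
case: b => r c [ib [mu hmu]]; have e i j := hmu (i, j).
rewrite /in_diagram /= in ib e.
have er : row_len lam r = c.+1 /\ row_len mu r = c.
  move: (e r c) (e r c.+1) (e r (row_len mu r)); rewrite !xpair_eqE !eqxx /=.
  lia.
have ei i : row_len mu i = (row_len lam i - (r == i))%N.
  case: (eqVneq r i) => [<-|ne]; first by case: er => -> ->; rewrite subn1.
  have := e i (row_len lam i); have := e i (row_len mu i).
  by rewrite !xpair_eqE eq_sym (negPf ne) /= !andbT !ltnn; case: ltngtP; lia.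
rewrite /removable /=; case: er => -> ecr; rewrite eqxx /=.
apply/sorted_geqP => i; rewrite !row_len_decr -!ei.
exact/sorted_geqP/intpart_sorted.
Qed.

Lemma mem_addables (lam : intpart) (b : box) :
  (b \in addables lam) = addable lam b.
Proof.
rewrite mem_filter andbC; case ad: (addable lam b); last by rewrite andbF.
rewrite andbT; apply/mapP; exists b.1.
  rewrite mem_iota /= add0n leqNgt; apply/negP => lt_b.
  case/andP: (ad) => _ /is_partP[+ _] => /(_ b.1.-1).
  have eb : b.1.-1.+1 = b.1 by lia.
  rewrite eb !row_len_incr eqxx.
  have -> : (b.1 == b.1.-1) = false by lia.
  by rewrite /row_len !nth_default //; lia.
by case/andP: ad => /eqP <- _; case: b.
Qed.

Lemma mem_removables (lam : intpart) (b : box) :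
  (b \in removables lam) = removable lam b.
Proof.
rewrite mem_filter andbC; case ad: (removable lam b); last by rewrite andbF.
rewrite andbT; case/andP: ad => /eqP h _; apply/mapP; exists b.1.
  by rewrite mem_iota /= add0n -row_gt0 -h.
by rewrite -h /=; case: b {h}.
Qed.

Lemma uniq_addables (lam : intpart) : uniq (addables lam).
Proof. by rewrite filter_uniq // map_inj_uniq ?iota_uniq // => i j []. Qed.

Lemma uniq_removables (lam : intpart) : uniq (removables lam).
Proof. by rewrite filter_uniq // map_inj_uniq ?iota_uniq // => i j []. Qed.

(* Boxes of A(lam) and R(lam) lie on pairwise distinct diagonals. *)
Lemma content_inj_AR (lam : intpart) :
  {in addables lam ++ removables lam &, injective content}.
Proof.
pose P (b : box) := (b.2 <= row_len lam b.1 <= b.2.+1)%N && (row_len lam b.1.+1 <= b.2)%N.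
have hP b : b \in addables lam ++ removables lam -> P b.
  have le1 := @row_le lam b.1 b.1.+1 (intpart_sorted lam) (leqnSn _).
  rewrite mem_cat mem_addables mem_removables.
  case/orP => /andP[/eqP eb]; rewrite /P; first by move=> _; rewrite eb leqnn leqnSn le1.
  move/sorted_geqP => /(_ b.1); rewrite !row_len_decr eqxx -eb ltn_eqF ?ltnSn //.
  by rewrite subn0 subn1 /= => ->; rewrite ?leqnn ?leqnSn ?andbT.
move=> b b' /hP Pb /hP Pb'; rewrite /content => eqc.
wlog lt : b b' Pb Pb' eqc / (b.1 <= b'.1)%N => [H|].
  by case: (leqP b.1 b'.1) => [|/ltnW] le; [|symmetry]; apply: H.
case: (eqVneq b.1 b'.1) => [e1|ne].
  by case: b b' eqc e1 {Pb Pb' lt} => i j [i' j'] /= eqc e1; congr (_, _); lia.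
have lt1 : (b.1.+1 <= b'.1)%N by lia.
have := row_le (intpart_sorted lam) lt1.
move: Pb Pb'; rewrite /P => /andP[_ h1] /andP[/andP[h2 _] _] h3.
have := leq_trans (leq_trans h2 h3) h1.
by case: b b' eqc lt1 {lt ne h1 h2 h3} => i j [i' j'] /=; lia.
Qed.

(* On boxes of the same color, geH compares heights first, then contents. *)
Lemma geHE (n : nat) (b b' : box) : (2 < n)%N -> color n b = color n b' ->
  content b != content b' ->
  geH n b b' = (height b' < height b) ||
               (height b == height b') && (content b' < content b).
Proof.
move=> n2 ecol nec.
have dvd : (n%:Z %| content b - content b')%Z.
  have : (content b - content b')%:~R == 0 :> 'Z_n.
    by rewrite intrB subr_eq0; apply/eqP; exact: ecol.
  have Zn k : (k%:R == 0 :> 'Z_n) = (n %| k)%N.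
    by rewrite -val_eqE /= val_Zp_nat /dvdn //; lia.
  rewrite -[X in X%:~R]intz; case: (content b - content b') => k.
    by rewrite intz -pmulrn Zn.
  by rewrite intz NegzE mulrNz oppr_eq0 -pmulrn Zn.
have {dvd ecol} [t et] : exists t : nat, `|content b - content b'|%N = (t * n)%N.
  by move: dvd; rewrite /dvdz /= => /dvdnP.
have t0 : (0 < t)%N by lia.
rewrite /geH et mulnK; last by lia.
have -> : (b == b') = false by apply: contraNF nec => /eqP ->.
have : (2 < n * t)%N by rewrite (leq_trans n2) // leq_pmulr.
rewrite [(t * n)%N]mulnC in et; rewrite /AH uphalfE.
move: (n * t)%N et => N et N2; rewrite -divn2.
move: nec et; rewrite /content /height /=; case: b b' => [i j] [i' j'] /=.
by case: ifP; lia.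
Qed.

(* Hence SH is the string of brackets in decreasing order. *)
Lemma geH_total (n : nat) (b b' : box) : (2 < n)%N -> color n b = color n b' ->
  content b != content b' -> geH n b b' = ~~ geH n b' b.
Proof.
move=> n2 ec nec; rewrite !geHE // 1?eq_sym //.
by move: nec; rewrite /content /height; case: b b' {ec} => [i j] [i' j'] /=; lia.
Qed.

Lemma geH_trans (n : nat) (b1 b2 b3 : box) : (2 < n)%N ->
  color n b1 = color n b2 -> color n b2 = color n b3 ->
  content b1 != content b2 -> content b2 != content b3 ->
  content b1 != content b3 ->
  geH n b1 b2 -> geH n b2 b3 -> geH n b1 b3.
Proof.
by move=> n2 e12 e23 d12 d23 d13; rewrite !geHE //; [lia | rewrite e12].
Qed.

Lemma maxZP (P : set int) (v B : int) :
  P v -> (forall w, P w -> w <= B) -> is_greatest P (maxZ P).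
Proof.
move=> Pv leB; rewrite /maxZ; apply: xgetPex.
have [k] := ubnP (absz (B - v)); elim: k v Pv => // k IH v Pv le_k.
have [[w [Pw lt_w]]|no] := pselect (exists w, P w /\ v < w).
  by apply: (IH w Pw); have := leB w Pw; have := leB v Pv; lia.
exists v; split=> // w Pw; rewrite leNgt; apply/negP => lt_w.
by apply: no; exists w.
Qed.

Lemma minZP (P : set int) (v B : int) :
  P v -> (forall w, P w -> B <= w) -> is_least P (minZ P).
Proof.
move=> Pv leB; rewrite /minZ; apply: xgetPex.
have [k] := ubnP (absz (v - B)); elim: k v Pv => // k IH v Pv le_k.
have [[w [Pw lt_w]]|no] := pselect (exists w, P w /\ w < v).
  by apply: (IH w Pw); have := leB w Pw; have := leB v Pv; lia.
exists v; split=> // w Pw; rewrite leNgt; apply/negP => lt_w.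
by apply: no; exists w.
Qed.

Lemma ler_sum_norm (T : eqType) (s : seq T) (P : pred T) (F : T -> int) :
  `|\sum_(x <- s | P x) F x| <= \sum_(x <- s) `|F x|.
Proof.
apply: le_trans (ler_norm_sum _ _ _) _; rewrite big_mkcond /=.
by apply: ler_sum => x _; case: ifP.
Qed.

Lemma mem_sum_norm (T : eqType) (s : seq T) (F : T -> int) x :
  x \in s -> `|F x| <= \sum_(y <- s) `|F y|.
Proof.
by move=> xs; rewrite (big_rem x xs) /= lerDl sumr_ge0.
Qed.

Lemma epsP (n : nat) (i : 'Z_n) (m : monomial n) :
  (exists L, epsL i L m = eps i m) /\ forall L, epsL i L m <= eps i m.
Proof.
have [] := @maxZP [set v | exists L, epsL i L m = v]%classic (epsL i 0 m)
  (\sum_(x <- dom m) `|expo m i x.2|).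
- by exists 0.
- move=> _ [L <-]; apply: le_trans (ler_norm _) _; rewrite normrN.
  exact: ler_sum_norm.
by move=> e h; split=> // L; apply: h; exists L.
Qed.

Lemma phiP (n : nat) (i : 'Z_n) (m : monomial n) :
  (exists L, phiL i L m = phi i m) /\ forall L, phiL i L m <= phi i m.
Proof.
have [] := @maxZP [set v | exists L, phiL i L m = v]%classic (phiL i 0 m)
  (\sum_(x <- dom m) `|expo m i x.2|).
- by exists 0.
- by move=> _ [L <-]; apply: le_trans (ler_norm _) _; exact: ler_sum_norm.
by move=> e h; split=> // L; apply: h; exists L.
Qed.

Lemma pMP (n : nat) (i : 'Z_n) (m : monomial n) : 0 < eps i m ->
  epsL i (pM i m) m = eps i m /\
  forall L, epsL i L m = eps i m -> L <= pM i m.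
Proof.
move=> e0; have [[L0 eL0] _] := epsP i m.
apply: (@maxZP [set L | epsL i L m = eps i m]%classic L0
  (\sum_(x <- dom m) `|x.2|) eL0) => L /= eL.
rewrite leNgt; apply/negP => ltL; move: e0; rewrite -eL /epsL big_seq_cond.
rewrite big_pred0 ?oppr0 ?ltxx // => x; apply/negP => /and3P[xm _ leL].
have le_x := le_trans (ler_norm _) (mem_sum_norm snd xm).
by have := lt_le_trans ltL (le_trans leL le_x); rewrite ltxx.
Qed.

Lemma qMP (n : nat) (i : 'Z_n) (m : monomial n) : 0 < phi i m ->
  phiL i (qM i m) m = phi i m /\
  forall L, phiL i L m = phi i m -> qM i m <= L.
Proof.
move=> e0; have [[L0 eL0] _] := phiP i m.
apply: (@minZP [set L | phiL i L m = phi i m]%classic L0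
  (- \sum_(x <- dom m) `|x.2|) eL0) => L /= eL.
rewrite leNgt; apply/negP => ltL; move: e0; rewrite -eL /phiL big_seq_cond.
rewrite big_pred0 ?ltxx // => x; apply/negP => /and3P[xm _ leL].
have := le_lt_trans leL ltL; rewrite ltrNr => lt_x.
have := lt_le_trans lt_x (ler_norm _); rewrite normrN => {}lt_x.
by have := lt_le_trans lt_x (mem_sum_norm snd xm); rewrite ltxx.
Qed.

(* Main.v *)
Require Import Defs.
From mathcomp Require Import all_boot all_order all_algebra.
From mathcomp Require Import zify.
From mathcomp Require Import freeg.

Set Implicit Arguments.
Unset Strict Implicit.
Unset Printing Implicit Defensive.

Import Order.TTheory GRing.Theory Num.Theory.

Local Open Scope ring_scope.

#[local] Arguments row_len : simpl never.

(** Both operators select a bracket in a word by partial sums of signs.  Attach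
    to every box [b] of color [i] in [A(lam)] the sign [1] and the level
    [h(b) - 1], and to every box [b] of color [i] in [R(lam)] the sign [-1] and
    the level [h(b) + 1]; this records
    the variable that the box contributes to [Psi lam].  Then [phiL i L] is the
    sum of the signs of the brackets of level at most [L] ([wsum_Psi]).

    The point is that, for [lam] in [BH], levels decrease weakly along the word
    [SH i lam], with opening brackets before closing ones inside a level
    ([SH_levels]).  The order of the word compares heights, then contents, so it
    could disagree with the order of levels only for an addable and a removable
    box whose heights are too close; such a pair spans a hook whose corner box is
    illegal ([BH_height]).  Consequently the brackets of level at most [L] form a
    suffix of the word and [phi] is its maximal suffix sum.  The first uncanceled
    opening bracket starts the shortest suffix of maximal sum
    ([uncanceled_open]), hence its level is [qM] ([threshold]); without such a
    bracket no suffix has a positive sum and both sides are [0].  The same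
    argument for the reversed word with opposite signs shows that [pM] is the
    level of the last uncanceled closing bracket.

    It remains to see that adding a box [b] divides [Psi] by [Amon] at the color
    and height of [b]: writing [Psi] as a sum over the right edges of rows
    ([Psi_rows]) makes this a computation with the four corners of [b]
    ([Psi_incr]). *)

(** * Corners of a partition and illegal boxes *)

Lemma addableE (lam : intpart) i j :
  addable lam (i, j) =
  (j == row_len lam i) && ((i == 0%N) || (row_len lam i < row_len lam i.-1)%N).
Proof.
rewrite /addable /=; case: eqP => //= _; apply/is_partP/idP => [[h _]|h].
  have := h i.-1; rewrite !row_len_incr; case: i {h} => [|i] //=; lia.
split=> [k|k]; rewrite !row_len_incr.
  have /sorted_geqP/(_ k) := intpart_sorted lam.
  by case: (eqVneq i k.+1) => [e|]; [subst i; move: h => /=; lia | lia].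
rewrite size_incr_nth; case: (ltnP i (size lam)) => [_|le_i].
  by rewrite -row_gt0 => hk; rewrite addn_gt0 hk orbT.
have i0 : row_len lam i = 0%N by apply/eqP; rewrite -leqn0 leqNgt row_gt0; lia.
case: (eqVneq i k) => [//|ne] ltk; have le_k : (k <= i.-1)%N by lia.
have := row_le (intpart_sorted lam) le_k; lia.
Qed.

Lemma removableE (lam : intpart) i j :
  removable lam (i, j) = (j.+1 == row_len lam i) && (row_len lam i.+1 <= j)%N.
Proof.
rewrite /removable /=; case: eqP => //= e; apply/sorted_geqP/idP => [/(_ i)|h k].
  rewrite !row_len_decr eqxx -e (_ : (i == i.+1) = false) /= ?subn0; lia.
have /sorted_geqP/(_ k) := intpart_sorted lam; rewrite !row_len_decr.
case: (eqVneq i k) => [<-|_]; last by lia.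
by rewrite (_ : (i == i.+1) = false) /= ?subn0; lia.
Qed.

Lemma ltn_col_len (lam : intpart) i j :
  (i < col_len lam j)%N = (j < row_len lam i)%N.
Proof.
have := intpart_sorted lam; rewrite /col_len /row_len.
elim: (rows lam) i => [|a s IH] i; first by rewrite nth_nil.
move=> srt; have /IH {}IH := path_sorted srt.
case: i => [|i] /=; last by rewrite -IH; have := row_le srt (leq0n i.+1);
  move: (IH i); rewrite /row_len /=; case: (ltnP j a); lia.
case: (ltnP j a) => //= le_aj; rewrite add0n IH.
by have := row_le srt (leq0n 1); rewrite /row_len /=; lia.
Qed.

Lemma eq_color_content n (b b' : box) : (2 < n)%N -> color n b = color n b' ->
  exists t : nat, `|content b - content b'|%N = (n * t)%N.
Proof.
move=> n2 ecol.
have : (content b - content b')%:~R == 0 :> 'Z_n.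
  by rewrite intrB subr_eq0; apply/eqP; exact: ecol.
have Zn k : (k%:R == 0 :> 'Z_n) = (n %| k)%N.
  by rewrite -val_eqE /= val_Zp_nat /dvdn //; lia.
case: (content b - content b') => k; first rewrite -pmulrn Zn.
  by case/dvdnP => t ->; exists t; rewrite mulnC.
rewrite NegzE mulrNz oppr_eq0 -pmulrn Zn.
by case/dvdnP => t e; exists t; rewrite mulnC -e; lia.
Qed.

(** This is where legality enters.  If the row of [a] is not below that of [r],
    let [b] be the box in the row of [a] and the column of [r]; otherwise the box
    in the row of [r] and the column of [a].  Then [b] lies in the diagram, its
    hook length is the content difference [n * t], and its arm is [AH n t]
    exactly when [height a - height r] is [0] or [1] in the first case, [1] or
    [2] in the second (one of the two, according to the parity of [n * t]).
    Excluding these values leaves, for [a] before [r], only a gap of at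
    least [2]. *)
Lemma BH_height n (lam : intpart) (a r : box) : (2 < n)%N -> BH n lam ->
  addable lam a -> removable lam r -> color n a = color n r ->
  geH n a r -> height r + 2 <= height a.
Proof.
move=> n2 hlam ha hr ecol.
have nec : content a != content r.
  apply/eqP => e; have ear : a = r.
    apply: (@content_inj_AR lam) => //;
      by rewrite mem_cat ?mem_addables ?mem_removables ?ha ?hr ?orbT.
  by have /removableP[+ _] := hr; have /addableP[+ _] := ha; rewrite ear => /negP.
rewrite geHE //.
have [t et] := eq_color_content n2 ecol.
case: a r ha hr nec et {ecol} => [ia ja] [ir jr].
rewrite addableE removableE => /andP[/eqP ea ha] /andP[/eqP er hr].
rewrite /content /height /= => nec et.
have t0 : (1 <= t)%N by case: t et => // ; lia.
have N0 : (2 < n * t)%N by nia.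
have mono := row_le (intpart_sorted lam).
have ill b : in_diagram lam b -> hook lam b = (n * t)%N -> arm lam b <> AH n t.
  by move=> ib hk ar; apply: (hlam b ib); exists t.
case: (leqP ia ir) => [le|lt].
  have lej := mono _ _ le.
  have cl : col_len lam jr = ir.+1.
    by move: (ltn_col_len lam ir jr) (ltn_col_len lam ir.+1 jr); lia.
  move: (ill (ia, jr)); rewrite /in_diagram /hook /arm /AH /= cl.
  by move: (n * t)%N N0 et => N; lia.
have lej : (row_len lam ia.-1 <= row_len lam ir)%N by apply: mono; lia.
have lej' := mono _ _ lt.
have cl : col_len lam ja = ia.
  by move: (ltn_col_len lam ia ja) (ltn_col_len lam ia.-1 ja); lia.
move: (ill (ir, ja)); rewrite /in_diagram /hook /arm /AH /= cl.
by move: (n * t)%N N0 et => N; lia.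
Qed.

(** * The monomial of a partition *)

(** The variable attached to the lattice point [(i, j)] of the boundary of a
    diagram.  An addable box [(i, j)] contributes its corner [(i, j)] nearest to
    the origin, a removable box [(i, j)] the inverse of the opposite corner
    [(i + 1, j + 1)]. *)
Definition Ycorner n (i j : nat) : monomial n := Y (j%:Z - i%:Z)%:~R (i + j)%:Z.

Lemma size_row0 (lam : intpart) i : (size lam <= i)%N -> row_len lam i = 0%N.
Proof. exact: nth_default. Qed.

(** The right edge of row [i], of length [p], contributes its two ends [(i, p)]
    and [(i + 1, p)] with opposite signs; when two consecutive rows have the same
    length their common end cancels, and what survives are the corners of the
    diagram.  Unlike the sum over corners, this sum changes in a single
    term when a box is added.  [M] is arbitrary so that two partitions with
    different numbers of rows can be compared. *)
Lemma Psi_rows n (lam : intpart) M : (size lam <= M)%N ->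
  Psi n (Some lam) = Some (Ycorner n M 0 +
    \sum_(0 <= i < M)
      (Ycorner n i (row_len lam i) - Ycorner n i.+1 (row_len lam i))).
Proof.
move=> leM; rewrite /Psi; congr Some.
have eA : \sum_(b <- addables lam) Y (color n b) (height b - 1) =
    Ycorner n 0 (row_len lam 0) +
    \sum_(0 <= i < M | (row_len lam i.+1 < row_len lam i)%N)
      Ycorner n i.+1 (row_len lam i.+1).
  rewrite big_filter big_map.
  have Vh j : Y (color n (j, row_len lam j)) (height (j, row_len lam j) - 1) =
      Ycorner n j (row_len lam j).
    by rewrite /Ycorner /color /height /content /=; congr Y; lia.
  under eq_bigr do rewrite Vh.
  under eq_bigl do rewrite addableE eqxx /=.
  rewrite -[iota _ _]/(index_iota 0 (size lam).+1) big_ltn_cond //=.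
  rewrite big_add1 /=; congr (_ + _).
  rewrite [RHS](big_cat_nat _ leM) //= [X in _ = _ + X]big_nat_cond.
  rewrite [X in _ = _ + X]big_pred0 ?addr0 // => i; apply/negP => /andP[].
  by move=> /andP[le _]; rewrite !size_row0 //; lia.
have eR : \sum_(b <- removables lam) Y (color n b) (height b + 1) =
    \sum_(0 <= i < M | (row_len lam i.+1 < row_len lam i)%N)
      Ycorner n i.+1 (row_len lam i).
  rewrite big_filter big_map.
  rewrite [RHS](big_cat_nat _ leM) //= [X in _ = _ + X]big_nat_cond.
  rewrite [X in _ = _ + X]big_pred0 ?addr0; last first.
    by move=> i; apply/negP => /andP[] /andP[le _]; rewrite !size_row0 //; lia.
  rewrite (_ : iota 0 (size lam) = index_iota 0 (size lam));
    last by rewrite /index_iota subn0.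
  rewrite big_nat_cond [RHS]big_nat_cond.
  apply: eq_big => i.
    case: (ltnP i (size lam)); rewrite ?andbF // => lt_i.
    rewrite removableE; have := row_gt0 lam i; rewrite lt_i; lia.
  case/andP => /andP[_ lt_i] _; have := row_gt0 lam i; rewrite lt_i.
  rewrite /Ycorner /color /height /content /= => h.
  by congr Y; [congr (_%:~R); lia | lia].
(* Consecutive rows of equal length contribute zero, so the condition can be
   dropped; shifting the index in the first sum gives the row form. *)
rewrite eA eR -addrA -sumrB.
rewrite (_ : \sum_(_ <= _ < _ | _) _ = \sum_(0 <= i < M)
    (Ycorner n i.+1 (row_len lam i.+1) - Ycorner n i.+1 (row_len lam i))).
  rewrite sumrB addrA.
  have -> : Ycorner n 0 (row_len lam 0) +
      \sum_(0 <= i < M) Ycorner n i.+1 (row_len lam i.+1) = \sum_(0 <= i < M.+1) Ycorner n i (row_len lam i).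
    by rewrite big_nat_recl.
  by rewrite big_nat_recr //= sumrB addrA size_row0 // [_ + Ycorner n M 0]addrC.
rewrite big_mkcond; apply: eq_bigr => i _; case: ltnP => // le.
have /sorted_geqP/(_ i) le' := intpart_sorted lam.
by rewrite (_ : row_len lam i.+1 = row_len lam i) ?subrr //; lia.
Qed.

Lemma corner_exchange (V : zmodType) (a b c d e s : V) :
  e + (a - b + s) = a + d - c - b + (e + (c - d + s)).
Proof.
rewrite [RHS]addrCA; congr (e + _); rewrite addrA; congr (_ + s).
by rewrite (addrAC _ (- c)) (addrAC a d) addrA subrK addrK.
Qed.

Lemma Amon_corners n r a :
  Amon (color n (r, a)) (height (r, a)) =
  Ycorner n r a + Ycorner n r.+1 a.+1 - Ycorner n r a.+1 - Ycorner n r.+1 a.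
Proof.
have e1 : color n (r, a) + 1 = (a.+1%:Z - r%:Z)%:~R.
  by rewrite -[1]/(1%:~R) -intrD /content /=; congr (_%:~R); lia.
have e2 : color n (r, a) - 1 = (a%:Z - r.+1%:Z)%:~R.
  by rewrite -[1]/(1%:~R) -intrB /content /=; congr (_%:~R); lia.
have e3 : color n (r, a) = (a.+1%:Z - r.+1%:Z)%:~R.
  by rewrite /color /content /=; congr (_%:~R); lia.
rewrite /Amon /Ycorner e1 e2 -e3; rewrite -[(a%:Z - r%:Z)%:~R]/(color n (r, a)).
by rewrite /height /=; congr (Y _ _ + Y _ _ - Y _ _ - Y _ _); lia.
Qed.

(** The four corners of the added box are the four factors of [Amon]. *)
Lemma Psi_incr n (mu nu : intpart) r m m' :
  (forall i, row_len nu i = ((r == i) + row_len mu i)%N) ->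
  Psi n (Some mu) = Some m -> Psi n (Some nu) = Some m' ->
  m = Amon (color n (r, row_len mu r)) (height (r, row_len mu r)) + m'.
Proof.
move=> h; set M := maxn (maxn (size mu) (size nu)) r.+1.
have hr : (r < M)%N by rewrite leq_max ltnSn orbT.
have hmu : (size mu <= M)%N by rewrite /M; lia.
have hnu : (size nu <= M)%N by rewrite /M; lia.
rewrite (Psi_rows n hmu) (Psi_rows n hnu) => -[<-] [<-].
move: (M) hr => K hr; rewrite !big_mkord.
rewrite !(bigD1 (Ordinal hr) isT) /=.
rewrite [X in _ = _ + (_ + (_ + X))](eq_bigr (fun i : 'I_K =>
  Ycorner n i (row_len mu i) - Ycorner n i.+1 (row_len mu i))); last first.
  move=> i ne; rewrite !h.
  by have /negPf -> : r != i by rewrite eq_sym.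
by rewrite h eqxx add1n Amon_corners -corner_exchange.
Qed.

(** * Cancellation of brackets *)

(** Named so that the sum has type [int] itself, as linear arithmetic expects,
    and not the carrier of an algebraic structure on [int]. *)
Definition total T (v : T -> int) (s : seq T) : int := \sum_(x <- s) v x.

Lemma total_nil T (v : T -> int) : total v [::] = 0.
Proof. exact: big_nil. Qed.

Lemma total_cons T (v : T -> int) x s : total v (x :: s) = v x + total v s.
Proof. exact: big_cons. Qed.

Lemma total_cat T (v : T -> int) s t : total v (s ++ t) = total v s + total v t.
Proof. exact: big_cat. Qed.

Definition nneg_prefixes T (v : T -> int) (s : seq T) :=
  forall s1 s2, s = s1 ++ s2 -> 0 <= total v s1.

Definition npos_suffixes T (v : T -> int) (s : seq T) :=
  forall s1 s2, s = s1 ++ s2 -> total v s2 <= 0.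

Lemma cat_eq_cat T (a b c d : seq T) : a ++ b = c ++ d ->
  (exists e, c = a ++ e /\ b = e ++ d) \/ (exists e, a = c ++ e /\ d = e ++ b).
Proof.
elim: a c => [|x a IH] [|y c] /=; try by move=> ->; left; exists (y :: c).
- by move=> ->; left; exists [::].
- by move=> <-; right; exists (x :: a).
case=> <- /IH[[e [-> ->]]|[e [-> ->]]]; [left|right]; by exists e.
Qed.

Lemma nneg_prefixes_cat T (v : T -> int) s t :
  nneg_prefixes v s -> nneg_prefixes v t -> nneg_prefixes v (s ++ t).
Proof.
move=> hs ht s1 s2 /cat_eq_cat[[e [-> e2]]|[e [e1 _]]]; last exact: hs e1.
by rewrite total_cat addr_ge0 //; [apply: (hs s [::]); rewrite cats0 | apply: ht e2].
Qed.

Lemma npos_suffixes_cat T (v : T -> int) s t :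
  npos_suffixes v s -> npos_suffixes v t -> npos_suffixes v (s ++ t).
Proof.
move=> hs ht s1 s2 /cat_eq_cat[[e [_ e2]]|[e [e1 ->]]]; first exact: ht e2.
by rewrite total_cat /=; have := hs _ _ e1; have := ht [::] t erefl; lia.
Qed.

Definition sgnb (p : bracket) : int := if p.1 then 1 else -1.
Definition balanced (s : seq bracket) := nneg_prefixes sgnb s /\ npos_suffixes sgnb s.

(** The normal form of a bracket word: [reads s st] says that deleting balanced
    factors from [s] leaves the letters of [st], last letter first. *)
Fixpoint reads (s st : seq bracket) : Prop :=
  if st is q :: st' then
    exists s1 s2, [/\ s = s1 ++ q :: s2, balanced s2 & reads s1 st']
  else balanced s.

Lemma nneg_prefixes_cons T (v : T -> int) x s : 0 <= v x -> nneg_prefixes v s ->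
  nneg_prefixes v (x :: s).
Proof.
move=> vx hs [|y s1] s2 /=; rewrite ?total_nil // => -[<- e].
by rewrite total_cons addr_ge0 //; apply: hs e.
Qed.

Lemma npos_suffixes_cons T (v : T -> int) x s : v x <= 0 -> npos_suffixes v s ->
  npos_suffixes v (x :: s).
Proof.
move=> vx hs; rewrite -cat1s; apply: npos_suffixes_cat => //.
by case=> [|y [|z s1]] s2 //= [] => [<-|_ <-];
  rewrite ?total_nil // total_cons total_nil addr0.
Qed.

Lemma balanced_nil : balanced [::].
Proof. by split=> -[|? ?] [|? ?] //; rewrite total_nil. Qed.

Lemma balanced_cat s t : balanced s -> balanced t -> balanced (s ++ t).
Proof.
move=> [p1 n1] [p2 n2]; split; [exact: nneg_prefixes_cat|exact: npos_suffixes_cat].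
Qed.

Lemma balanced_sum s : balanced s -> total sgnb s = 0.
Proof.
case=> p m; have := m [::] s erefl; have := p s [::]; rewrite cats0 => /(_ erefl).
lia.
Qed.

Lemma balanced_wrap (q p : bracket) s :
  q.1 -> ~~ p.1 -> balanced s -> balanced (q :: s ++ [:: p]).
Proof.
move=> q1 p1 bs; have s0 := balanced_sum bs; case: bs => hp hn; split.
  case=> [|x s1] s2 /=; first by rewrite total_nil.
  case=> <- /cat_eq_cat[[e [-> ee]]|[e [ee _]]]; last first.
    rewrite total_cons; have := hp _ _ ee; rewrite /sgnb q1; lia.
  rewrite total_cons total_cat /= s0; case: e ee => [|y [|z e]] //= [].
    by rewrite total_nil /sgnb q1.
  by move=> <- _; rewrite total_cons total_nil /sgnb q1 (negPf p1).
case=> [|x s1] s2 /=.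
  by move=> <-; rewrite total_cons total_cat /= s0 total_cons total_nil /sgnb q1 (negPf p1).
case=> _ /cat_eq_cat[[e [_ ee]]|[e [ee ->]]].
  case: e ee => [|y [|z e]] //= []; last by move=> _ <-; rewrite total_nil.
  by move=> <-; rewrite total_cons total_nil /sgnb (negPf p1).
by rewrite total_cat /=; have := hn _ _ ee; rewrite total_cons total_nil /sgnb (negPf p1); lia.
Qed.

Lemma reads_cat s w st : reads s st -> balanced w -> reads (s ++ w) st.
Proof.
case: st => [|q st] /=; first exact: balanced_cat.
move=> [s1 [s2 [-> b2 r1]]] bw; exists s1, (s2 ++ w).
by rewrite -catA; split=> //; apply: balanced_cat.
Qed.

(** Reading a closing bracket on top of an opening one encloses the balanced
    factor between them in a larger balanced factor. *)
Lemma reads_step s st p : reads s st -> reads (s ++ [:: p]) (cancel_step st p).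
Proof.
have push : reads s st -> reads (s ++ [:: p]) (p :: st).
  by move=> r; exists s, [::]; split=> //; exact: balanced_nil.
case: st push => [|q st] push; first exact: push.
move=> r; rewrite /cancel_step; case: ifP => [/andP[q1 p1]|_]; last exact: push.
case: r => s1 [s2 [-> b2 r1]]; rewrite -catA; apply: reads_cat => //.
exact: balanced_wrap.
Qed.

Lemma reads_foldl s : reads s (foldl cancel_step [::] s).
Proof.
elim/last_ind: s => [|s p IH]; first exact: balanced_nil.
by rewrite -cats1 foldl_cat; exact: reads_step.
Qed.

Lemma reads_split s st1 q st2 : reads s (st1 ++ q :: st2) ->
  exists s1 s2, [/\ s = s1 ++ q :: s2, reads s1 st2 & reads s2 st1].
Proof.
elim: st1 s => [|p st1 IH] s /= [s1 [s2 [-> b2]]].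
  by move=> r; exists s1, s2.
case/IH => t1 [t2 [-> r1 r2]]; exists t1, (t2 ++ p :: s2); rewrite -catA; split=> //.
by exists t2, s2.
Qed.

Lemma reads_nneg s st : reads s st -> all fst st -> nneg_prefixes sgnb s.
Proof.
elim: st s => [|q st IH] s /=; first by case.
case=> s1 [s2 [-> [p2 _] /IH r1]] /andP[q1 /r1 p1].
by apply: nneg_prefixes_cat => //; apply: nneg_prefixes_cons => //; rewrite /sgnb q1.
Qed.

Lemma reads_npos s st : reads s st -> ~~ has fst st -> npos_suffixes sgnb s.
Proof.
elim: st s => [|q st IH] s /=; first by case.
case=> s1 [s2 [-> [_ p2] /IH r1]]; rewrite negb_or => /andP[q1 /r1 p1].
by apply: npos_suffixes_cat => //; apply: npos_suffixes_cons => //; rewrite /sgnb (negPf q1).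
Qed.

(** A closing bracket is pushed only when no opening bracket is on top, so the
    uncanceled closing brackets all come before the uncanceled opening ones. *)
Lemma stack_shape s : let st := foldl cancel_step [::] s in
  exists ups downs, [/\ st = ups ++ downs, all fst ups & ~~ has fst downs].
Proof.
elim/last_ind: s => [|s p [ups [downs [e hu hd]]]]; first by exists [::], [::].
rewrite -cats1 foldl_cat /= in e *; rewrite e.
case: ups hu {e} => [|q ups] /= hu.
  case p1 : p.1.
    exists [:: p], downs; split; rewrite /= ?p1 //.
    by case: downs hd => //= q downs; rewrite negb_or => /andP[/negPf -> _].
  exists [::], (p :: downs); split; rewrite /= ?p1 //.
  by case: downs hd => //= q downs; rewrite negb_or => /andP[/negPf -> _].
case/andP: hu => q1 hu; rewrite q1 /=; case: ifP => p1; first by exists ups, downs.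
by exists (p :: q :: ups), downs; split; rewrite //= q1 hu -(negbK p.1) p1.
Qed.

(** To the left of the first uncanceled opening bracket there are only balanced
    factors and closing brackets, to its right balanced factors and opening
    brackets.  In terms of signs, this says where the suffix sums of the word are
    maximal. *)
Lemma uncanceled_open s :
  if ohead [seq p.2 | p <- uncanceled s & p.1] is Some b then
    exists s1 s2, [/\ s = s1 ++ (true, b) :: s2, npos_suffixes sgnb s1
      & nneg_prefixes sgnb s2]
  else npos_suffixes sgnb s.
Proof.
rewrite /uncanceled; have := reads_foldl s.
have [ups [downs [-> hu hd]]] := stack_shape s.
rewrite rev_cat filter_cat (_ : filter _ (rev downs) = [::]) /=; last first.
  by apply/eqP; rewrite -[_ == _]negbK -has_filter has_rev.
rewrite (_ : filter _ (rev ups) = rev ups); last by apply/all_filterP; rewrite all_rev.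
case/lastP: ups hu => [|ups [c b]]; first by move=> _ /reads_npos /(_ hd).
rewrite all_rcons /= => /andP[c1 hu]; rewrite rev_rcons /= cat_rcons => /reads_split.
case=> s1 [s2 [-> r1 r2]]; exists s1, s2; case: c c1 => // _; split=> //.
  exact: reads_npos r1 hd.
exact: reads_nneg r2 hu.
Qed.

(** The last uncanceled closing bracket cuts the word with the same two sign
    conditions, because it sits at the other side of the same boundary between
    the two uncanceled blocks. *)
Lemma uncanceled_close s :
  if ohead (rev [seq p.2 | p <- uncanceled s & ~~ p.1]) is Some b then
    exists s1 s2, [/\ s = s1 ++ (false, b) :: s2, npos_suffixes sgnb s1
      & nneg_prefixes sgnb s2]
  else nneg_prefixes sgnb s.
Proof.
rewrite /uncanceled; have := reads_foldl s.
have [ups [downs [-> hu hd]]] := stack_shape s.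
rewrite rev_cat filter_cat (_ : filter _ (rev ups) = [::]) /=; last first.
  apply/eqP; rewrite -[_ == _]negbK -has_filter has_rev -all_predC.
  by apply: sub_all hu => x /=; rewrite negbK.
rewrite (_ : filter _ (rev downs) = rev downs); last first.
  by apply/all_filterP; rewrite all_rev all_predC.
rewrite cats0 map_rev revK.
case: downs hd => [|[c b] downs]; first by rewrite cats0 => _ /reads_nneg /(_ hu).
rewrite /= negb_or => /andP[c1 hd] /reads_split.
case=> s1 [s2 [-> r1 r2]]; exists s1, s2; case: c c1 => // _; split=> //.
  exact: reads_npos r1 hd.
exact: reads_nneg r2 hu.
Qed.

(** * Partial sums over levels *)

Lemma pairwise_split T (k : T -> int) (s : seq T) L :
  pairwise (fun p q => k q <= k p) s ->
  s = [seq x <- s | L < k x] ++ [seq x <- s | k x <= L].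
Proof.
elim: s => //= x s IH /andP[hx /IH {}IH].
case: ltP => h /=; first by rewrite {1}IH.
have al : all (fun y => k y <= L) s by apply: sub_all hx => y hy; exact: le_trans hy h.
rewrite (_ : [seq y <- s | L < k y] = [::]) /= ?(all_filterP al) //.
apply/nilP; rewrite /nilp size_filter -leqn0 leqNgt -has_count -all_predC.
by apply: sub_all al => y /=; rewrite -leNgt.
Qed.

Lemma total_ge0 T (v : T -> int) s : all (fun y => 0 <= v y) s -> 0 <= total v s.
Proof.
elim: s => [|x s IH] /=; first by rewrite total_nil.
by rewrite total_cons => /andP[? /IH]; lia.
Qed.

Lemma total_filterC T (v : T -> int) (a b : pred T) s :
  (forall x, b x = ~~ a x) ->
  total v s = total v (filter a s) + total v (filter b s).
Proof.
move=> e; elim: s => [|x s IH] /=; rewrite ?total_nil // total_cons e IH.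
by case: (a x); rewrite /= total_cons; lia.
Qed.

(** When levels decrease along the word, the letters of level at most [L] form
    a suffix, so [phi] takes values among the suffix sums.  The sign conditions
    make the suffix starting at [x] the shortest of maximal sum.  It may miss
    some letters of level [k x], but those precede [x] and have nonnegative
    weight by the second hypothesis, while they form a suffix of [s1]: their
    weights add up to [0]. *)
Lemma threshold T (v k : T -> int) s1 x s2 :
  pairwise (fun p q => k q <= k p) (s1 ++ x :: s2) ->
  all (fun y => (v y < 0) ==> (k x < k y)) s1 -> v x = 1 ->
  npos_suffixes v s1 -> nneg_prefixes v s2 ->
  let phi L := total v [seq y <- s1 ++ x :: s2 | k y <= L] in
  [/\ 0 < phi (k x), forall L, phi L <= phi (k x)
    & forall L, phi L = phi (k x) -> k x <= L].
Proof.
move=> pw hs1 vx n1 p2 phi.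
have [pw1 [pwx [pw2 pw12]]] : pairwise (fun p q => k q <= k p) s1 /\
   all (fun y => k y <= k x) s2 /\ pairwise (fun p q => k q <= k p) s2 /\ 
   all (fun y => k x <= k y) s1.
  move: pw; rewrite pairwise_cat /= => /and3P[h1 -> /andP[-> ->]].
  do 3!split=> //.
  by apply: sub_all h1 => y /= /andP[].
have e1 L : phi L =
    total v [seq y <- s1 | k y <= L] + (if k x <= L then 1 else 0) +
    total v [seq y <- s2 | k y <= L].
  rewrite /phi filter_cat total_cat /=; case: ifP => _; last by rewrite addr0.
  by rewrite total_cons vx; lia.
have s2ge : 0 <= total v s2 by apply: (p2 s2 [::]); rewrite cats0.
have f2 : total v [seq y <- s2 | k y <= k x] = total v s2 by rewrite (all_filterP pwx).
have f1 : total v [seq y <- s1 | k y <= k x] = 0.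
  have := n1 _ _ (pairwise_split (k x) pw1).
  have : 0 <= total v [seq y <- s1 | k y <= k x].
    apply: total_ge0; rewrite all_filter; apply: sub_all hs1 => y /=; lia.
  lia.
have S1 L : total v [seq y <- s1 | k y <= L] <= 0 by apply: n1 (pairwise_split L pw1).
have S2 L : total v [seq y <- s2 | k y <= L] <= total v s2.
  rewrite [X in _ <= X](@total_filterC _ _ (fun y => L < k y) (fun y => k y <= L));
    last by move=> y; rewrite -leNgt.
  by have := p2 _ _ (pairwise_split L pw2); lia.
have phix : phi (k x) = 1 + total v s2 by rewrite e1 f1 f2 lexx add0r.
have lt L : L < k x -> phi L < phi (k x).
  rewrite phix e1 => ltL; rewrite leNgt ltL /=; have := S1 L; have := S2 L; lia.
split; first by rewrite phix; lia.
- move=> L; case: (leP (k x) L) => [le|/lt /ltW //].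
  by rewrite phix e1 le; have := S1 L; have := S2 L; lia.
- by move=> L e; rewrite leNgt; apply/negP => /lt; rewrite e ltxx.
Qed.

(** * Reversed words *)

(** Reversing a word and changing all signs exchanges the two sign conditions;
    it also turns [epsL] into a sum of the form treated by [threshold]. *)
Lemma total_rev T (v : T -> int) s : total (fun x => - v x) (rev s) = - total v s.
Proof.
elim: s => [|x s IH]; first by rewrite !total_nil oppr0.
by rewrite rev_cons -cats1 total_cat total_cons total_nil IH total_cons addr0; lia.
Qed.

Lemma npos_suffixes_rev T (v : T -> int) s :
  nneg_prefixes v s -> npos_suffixes (fun x => - v x) (rev s).
Proof.
move=> h s1 s2 e; rewrite -[s2]revK total_rev oppr_le0; apply: (h _ (rev s1)).
by rewrite -rev_cat -e revK.
Qed.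

Lemma nneg_prefixes_rev T (v : T -> int) s :
  npos_suffixes v s -> nneg_prefixes (fun x => - v x) (rev s).
Proof.
move=> h s1 s2 e; rewrite -[s1]revK total_rev oppr_ge0; apply: (h (rev s2)).
by rewrite -rev_cat -e revK.
Qed.

Lemma pairwise_rev T (r : rel T) s :
  pairwise r (rev s) = pairwise (fun x y => r y x) s.
Proof.
by elim: s => // x s IH; rewrite rev_cons pairwise_rcons all_rev IH.
Qed.

(** * Partial sums of exponents *)

(** The sum of the exponents of the variables selected by [P], defined by linear
    extension so that additivity in the monomial is immediate. *)
Definition wsum n (P : pred ('Z_n * int)) (m : monomial n) : int :=
  fglift (fun x => (P x)%:R : int^o) m.

Lemma wsumB n P : {morph @wsum n P : m m' / m - m'}.
Proof. exact: (@lift_is_additive int _ int^o). Qed.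

Lemma wsum0 n P : @wsum n P 0 = 0.
Proof. by rewrite -[0 in LHS](subrr 0) wsumB subrr. Qed.

Lemma wsumD n P : {morph @wsum n P : m m' / m + m'}.
Proof. by move=> m m'; rewrite -{1}[m']opprK -[- m']sub0r !wsumB wsum0 sub0r opprK. Qed.

Lemma wsumU n P k x : @wsum n P << k *g x >> = k * (P x)%:R.
Proof. rewrite /wsum liftU. by []. Qed.

Lemma wsum_dom n P m : @wsum n P m = \sum_(x <- dom m | P x) coeff x m.
Proof.
rewrite -{1}[m]freeg_sumE (big_morph _ (@wsumD n P) (@wsum0 n P)) [RHS]big_mkcond.
by apply: eq_bigr => x _; rewrite wsumU; case: (P x); rewrite ?mulr1 ?mulr0.
Qed.

Lemma epsL_wsum n (i : 'Z_n) L m :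
  epsL i L m = - wsum (fun x => (x.1 == i) && (L <= x.2)) m.
Proof.
rewrite /epsL wsum_dom /expo; congr (- _); apply: eq_bigr => -[j l] /andP[/eqP /= -> _] //.
Qed.

Lemma phiL_wsum n (i : 'Z_n) L m :
  phiL i L m = wsum (fun x => (x.1 == i) && (x.2 <= L)) m.
Proof.
rewrite /phiL wsum_dom /expo; apply: eq_bigr => -[j l] /andP[/eqP /= -> _] //.
Qed.

(** * Levels of the brackets of a partition *)

(** The second index of the variable that a bracket contributes to [Psi]. *)
Definition level (p : bracket) : int :=
  if p.1 then height p.2 - 1 else height p.2 + 1.

Lemma wsum_Psi n (i : 'Z_n) (lam : intpart) (Q : pred int) m :
  Psi n (Some lam) = Some m ->
  wsum (fun x => (x.1 == i) && Q x.2) m =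
    total sgnb [seq p <- SH i lam | Q (level p)].
Proof.
case=> <-; rewrite wsumB !(big_morph _ (@wsumD n _) (@wsum0 n _)).
have -> : total sgnb [seq p <- SH i lam | Q (level p)] =
    \sum_(p <- brackets i lam | Q (level p)) sgnb p.
  by rewrite /total big_filter; apply: perm_big; rewrite perm_sort.
rewrite /brackets; move: (addables lam) (removables lam) => sA sR.
rewrite big_cat big_map big_map !big_filter_cond -sumrN.
by congr (_ + _); rewrite [RHS]big_mkcond; apply: eq_bigr => b _;
  rewrite wsumU mul1r /=; case: ifP => //; rewrite ?oppr0.
Qed.

Lemma brackets_color n (i : 'Z_n) lam p : p \in brackets i lam ->
  color n p.2 = i /\ if p.1 then addable lam p.2 else removable lam p.2.
Proof.
rewrite mem_cat => /orP[] /mapP[b]; rewrite mem_filter => /andP[/eqP hc hb] -> /=.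
  by rewrite -mem_addables.
by rewrite -mem_removables.
Qed.

Lemma brackets_content n (i : 'Z_n) lam p q :
  p \in brackets i lam -> q \in brackets i lam ->
  p.2 != q.2 -> content p.2 != content q.2.
Proof.
move=> /brackets_color[_ hp] /brackets_color[_ hq]; apply: contra => /eqP e.
apply/eqP; apply: (@content_inj_AR lam) => //;
  rewrite mem_cat mem_addables mem_removables.
  by move: hp; case: p.1 => ->; rewrite ?orbT.
by move: hq; case: q.1 => ->; rewrite ?orbT.
Qed.

Lemma geH_refl n b : geH n b b.
Proof. by rewrite /geH eqxx. Qed.

Lemma SH_pairwise n (i : 'Z_n) lam : (2 < n)%N ->
  pairwise (fun p q => geH n p.2 q.2) (SH i lam).
Proof.
move=> n2; have col p : p \in brackets i lam -> color n p.2 = i by case/brackets_color.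
have con := @brackets_content n i lam.
have allS s : perm_eq s (brackets i lam) -> all (mem (brackets i lam)) s.
  by move=> /perm_mem e; apply/allP => p; rewrite e.
rewrite -(@sorted_pairwise_in _ (mem (brackets i lam))).
- apply: (@sort_sorted_in _ (mem (brackets i lam))); last exact: allS.
  move=> p q /= hp hq; case: (eqVneq p.2 q.2) => [->|ne]; first by rewrite geH_refl.
  by rewrite (@geH_total n p.2 q.2) ?col // ?con //; case: geH.
- move=> q p r hq hp hr /=.
  case: (eqVneq p.2 q.2) => [->//|npq]; case: (eqVneq q.2 r.2) => [->//|nqr].
  case: (eqVneq p.2 r.2) => [->|npr]; first by rewrite geH_refl.
  by apply: geH_trans; rewrite ?col ?con.
- by apply: allS; rewrite perm_sort.
Qed.

(** For a legal partition the order of the brackets refines the decreasing order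
    of levels, and within one level opening brackets come first.  Only the case
    of an opening bracket preceding a closing one needs legality. *)
Lemma SH_levels n (i : 'Z_n) lam : (2 < n)%N -> BH n lam ->
  pairwise (fun p q => (level q <= level p) &&
                       (q.1 && ~~ p.1 ==> (level q < level p))) (SH i lam).
Proof.
move=> n2 hlam; apply: (@sub_in_pairwise _ (mem (brackets i lam))
  (fun p q => geH n p.2 q.2)); last exact: SH_pairwise.
2: by apply/allP => p; rewrite mem_sort.
  move=> p q hp hq /= pq.
  have [cp ap] := brackets_color hp; have [cq aq] := brackets_color hq.
  have hpq : height q.2 <= height p.2.
    case: (eqVneq p.2 q.2) => [->//|ne]; move: pq.
    rewrite geHE // ?cp ?cq // ?(brackets_content hp hq) //.
    by case/orP => [/ltW //|/andP[/eqP -> _]].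
  move: ap aq pq hpq; rewrite /level; case: p.1; case: q.1 => ap aq pq hpq /=;
    rewrite ?andbT ?lerD2r //.
- have := BH_height n2 hlam ap aq _ pq; rewrite cp cq => /(_ erefl).
  by move: (height p.2) (height q.2) => x y; lia.
- by move: (height p.2) (height q.2) hpq => x y; lia.
Qed.

(** * The two operators *)

Lemma Psi_fH n (i : 'Z_n) lam : (2 < n)%N -> BH n lam ->
  Psi n (fH i (Some lam)) = fM i (Psi n (Some lam)).
Proof.
move=> n2 hlam; case em : (Psi n (Some lam)) => [m|//].
have phiE L : phiL i L m = total sgnb [seq p <- SH i lam | level p <= L].
  by rewrite phiL_wsum (@wsum_Psi _ i lam (fun l => l <= L)).
have [[L0 eL0] phi_max] := phiP i m.
have lev := SH_levels i n2 hlam.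
have dec : pairwise (fun p q => level q <= level p) (SH i lam).
  by apply: sub_pairwise lev => p q /andP[].
rewrite /fH /fM; have := uncanceled_open (SH i lam).
case: ohead => [b|neg]; last first.
  by rewrite -eL0 phiE ltNge (neg _ _ (pairwise_split L0 dec)).
case=> s1 [s2 [e neg1 pos2]].
have bS : (true, b) \in brackets i lam.
  rewrite -(mem_sort (fun p q => geH n p.2 q.2)) -/(SH i lam) e.
  by rewrite mem_cat inE eqxx orbT.
have [cb ab] : color n b = i /\ addable lam b := brackets_color bS.
have [] := @threshold _ sgnb level s1 (true, b) s2 _ _ erefl neg1 pos2;
  rewrite -?e //.
  move: lev; rewrite e pairwise_cat => /andP[h _]; move: h.
  rewrite allrel_consr => /andP[h _].
  by apply: sub_all h => -[[] c] //= /andP[_].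
move=> phi0 phile phieq.
have eE : phiL i (height b - 1) m =
    total sgnb [seq p <- SH i lam | level p <= level (true, b)] by rewrite phiE.
rewrite -eE in phi0 phile phieq.
have ephi : phi i m = phiL i (height b - 1) m.
  by apply: le_anti; rewrite phi_max andbT -eL0 [X in X <= _]phiE phile.
have [q1 q2] : phiL i (qM i m) m = phi i m /\
    forall L, phiL i L m = phi i m -> qM i m <= L.
  by apply: qMP; rewrite ephi.
have -> : qM i m = height b - 1.
  by apply: le_anti; rewrite q2 // (phieq (qM i m)) // -phiE q1 ephi.
rewrite ephi phi0 subrK.
have row j : row_len (add_box lam b) j = ((b.1 == j) + row_len lam j)%N.
  by rewrite add_boxE // row_len_incr.
case em' : (Psi n (Some (add_box lam b))) => [m'|//]; congr Some.
rewrite (Psi_incr row em em').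
have -> : (b.1, row_len lam b.1) = b by case/andP: ab => /eqP <- _; case: (b).
by rewrite cb addKr.
Qed.
(** The argument of [Psi_fH] for the reversed word, with opposite signs and
    levels: [epsL] sums over large levels and [pM] is a greatest element. *)
Lemma Psi_eH n (i : 'Z_n) lam : (2 < n)%N -> BH n lam ->
  Psi n (eH i (Some lam)) = eM i (Psi n (Some lam)).
Proof.
move=> n2 hlam; case em : (Psi n (Some lam)) => [m|//].
have epsE L : epsL i L m =
    total (fun p => - sgnb p) [seq p <- rev (SH i lam) | - level p <= - L].
  rewrite epsL_wsum (@wsum_Psi _ i lam (fun l => L <= l) _ em) -total_rev filter_rev.
  congr (total _ (rev _)).
  by apply: eq_filter => p; rewrite lerN2.
have [[L0 eL0] eps_max] := epsP i m.
have lev := SH_levels i n2 hlam.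
have dec : pairwise (fun p q => - level q <= - level p) (rev (SH i lam)).
  rewrite pairwise_rev; apply: sub_pairwise lev => p q /andP[le _].
  by rewrite lerN2.
rewrite /eH /eM; have := uncanceled_close (SH i lam).
case: ohead => [b|/npos_suffixes_rev neg]; last first.
  by rewrite -eL0 epsE ltNge (neg _ _ (pairwise_split (- L0) dec)).
case=> s1 [s2 [e /nneg_prefixes_rev pos1 /npos_suffixes_rev neg2]].
have er : rev (SH i lam) = rev s2 ++ (false, b) :: rev s1.
  by rewrite e rev_cat rev_cons cat_rcons.
have bS : (false, b) \in brackets i lam.
  rewrite -(mem_sort (fun p q => geH n p.2 q.2)) -/(SH i lam) e.
  by rewrite mem_cat inE eqxx orbT.
have [cb ab] : color n b = i /\ removable lam b := brackets_color bS.
have [] := @threshold _ _ (fun p => - level p) _ (false, b) _ _ _ erefl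
  neg2 pos1; rewrite -?er //.
  move: lev; rewrite e pairwise_cat /= => /and3P[_ _ /andP[h _]].
  by rewrite all_rev; apply: sub_all h => -[[] c] //= /andP[_]; rewrite ltrN2.
move=> eps0 epsle epseq.
have eE : epsL i (height b + 1) m = total (fun p => - sgnb p)
    [seq p <- rev (SH i lam) | - level p <= - level (false, b)] by rewrite epsE.
rewrite -eE in eps0 epsle epseq.
have eeps : eps i m = epsL i (height b + 1) m.
  by apply: le_anti; rewrite eps_max andbT -eL0 [X in X <= _]epsE epsle.
have [p1 p2] : epsL i (pM i m) m = eps i m /\
    forall L, epsL i L m = eps i m -> L <= pM i m.
  by apply: pMP; rewrite eeps.
have -> : pM i m = height b + 1.
  apply: le_anti; rewrite p2 // andbT -lerN2; apply: epseq.
  by rewrite -epsE p1 eeps.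
rewrite eeps eps0 addrK.
have rb : row_len lam b.1 = b.2.+1 by case/andP: ab => /eqP <-.
have row j : row_len lam j = ((b.1 == j) + row_len (rem_box lam b) j)%N.
  rewrite rem_boxE // /shrink row_len_filter; last by case/andP: ab.
  by rewrite row_len_decr; case: eqP => [<-|]; lia.
case em' : (Psi n (Some (rem_box lam b))) => [m'|//]; congr Some.
rewrite (Psi_incr row em' em).
have -> : (b.1, row_len (rem_box lam b) b.1) = b.
  have -> : row_len (rem_box lam b) b.1 = b.2.
    by have := row b.1; rewrite eqxx rb; lia.
  by case: (b).
by rewrite cb.
Qed.

Theorem theorem5p1 (n : nat) (hn : (3 <= n)%N) (i : 'Z_n) (lam : intpart)
    (hlam : BH n lam) :
  Psi n (eH i (Some lam)) = eM i (Psi n (Some lam)) /\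
  Psi n (fH i (Some lam)) = fM i (Psi n (Some lam)).
Proof. by split; [exact: Psi_eH | exact: Psi_fH]. Qed.
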